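(* For every $n\ge0$ and every $f\in\mathcal{H}_\infty$, $$\sum_{w\in W_n}\|S_wf\|^2=\|f\|^2.$$ Equivalently, $$\sum_{w\in W_n}S_w^*S_w=I_{\mathcal{H}_\infty}.$$
   Context: Let $X$ be a set, $m\ge1$ an integer, and $\varphi_1,\dots,\varphi_m:X\to X$ maps. A kernel $J:Y\times Y\to\mathbb{C}$ is positive definite if $\sum_{\alpha,\beta}\overline{c_\alpha}c_\beta J(s_\alpha,s_\beta)\ge0$ for all finite families $(c_\alpha,s_\alpha)\in\mathbb{C}\times Y$; $J_1\le J_2$ means that $J_2-J_1$ is positive definite. The pullback operator is $(LJ)(s,t):=\sum_{i=1}^m J(\varphi_i(s),\varphi_i(t))$. Fix a positive definite kernel $K$ on $X$ with $LK\ge K$. Set $K_0:=K$, $K_{n+1}:=LK_n$, $u_n(s):=K_n(s,s)$ (nondecreasing in $n$), $u_\infty(s):=\lim_nu_n(s)\in[0,\infty]$, $X_{\mathrm{fin}}:=\{s\in X:u_\infty(s)<\infty\}$. Each $\varphi_i$ maps $X_{\mathrm{fin}}$ into itself. For $s,t\in X_{\mathrm{fin}}$ the limit $K_\infty(s,t):=\lim_nK_n(s,t)$ exists; $K_\infty$ is positive definite on $X_{\mathrm{fin}}$ and $LK_\infty=K_\infty$ there. $\mathcal{H}_\infty:=\mathcal{H}(K_\infty)$ is the reproducing kernel Hilbert space of $K_\infty$ on $X_{\mathrm{fin}}$, with kernel sections $k_s:=K_\infty(\cdot,s)$. Let $V:\mathcal{H}_\infty\to\mathcal{H}_\infty^{\oplus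 m}$ be the isometry (splitting isometry) uniquely determined among bounded linear maps by $Vk_s=(k_{\varphi_1(s)},\dots,k_{\varphi_m(s)})$ for all $s\in X_{\mathrm{fin}}$, and let $S_1,\dots,S_m:\mathcal{H}_\infty\to\mathcal{H}_\infty$ be its coordinate operators, $Vf=(S_1f,\dots,S_mf)$. With $W_n:=\{1,\dots,m\}^n$ and $W_0=\{\emptyset\}$, for $w=i_1\cdots i_n\in W_n$ put $S_w:=S_{i_n}\cdots S_{i_1}$ ($S_\emptyset=I$). *)

(* Defs.v *)
From HB Require Import structures.
From mathcomp Require Import all_boot all_order all_algebra.
From mathcomp Require Import complex.
From mathcomp Require Import all_classical all_reals all_analysis.

Set Implicit Arguments.
Unset Strict Implicit.
Unset Printing Implicit Defensive.

Import Order.TTheory GRing.Theory Num.Theory.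
Import numFieldNormedType.Exports.

Local Open Scope classical_set_scope.
Local Open Scope complex_scope.
Local Open Scope ring_scope.

(* The order of [R[i]] is partial: [0 <= z] means that z is real and nonnegative. *)
Definition posdef (R : realType) (Y : Type) (J : Y -> Y -> R[i]) : Prop :=
  forall (n : nat) (c : 'I_n -> R[i]) (s : 'I_n -> Y),
    0 <= \sum_(a < n) \sum_(b < n) Num.conj (c a) * c b * J (s a) (s b).

Definition kernel_le (R : realType) (Y : Type) (J1 J2 : Y -> Y -> R[i]) : Prop :=
  posdef (fun s t => J2 s t - J1 s t).

Definition pullback (R : realType) (X : Type) (m : nat) (phi : 'I_m -> X -> X)
    (J : X -> X -> R[i]) : X -> X -> R[i] :=
  fun s t => \sum_(i < m) J (phi i s) (phi i t).

Section SplittingKernel.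
Variables (R : realType) (X : Type) (m : nat).
Variables (phi : 'I_m -> X -> X) (K : X -> X -> R[i]).

Definition Kseq (n : nat) : X -> X -> R[i] := iter n (pullback phi) K.

Definition diag_seq (n : nat) (s : X) : R := complex.Re (Kseq n s s).

Definition diag_lim (s : X) : \bar R := limn (fun n => (diag_seq n s)%:E).

Definition Xfin : set X := [set s | (diag_lim s < +oo)%E].

(* [R[i]^o] is [R[i]] with the topology given by its norm. *)
Definition Kinf (s t : Xfin) : R[i] :=
  limn (fun n => Kseq n (val s) (val t) : R[i]^o).

Lemma posdef_diag (Y : Type) (J : Y -> Y -> R[i]) s : posdef J -> 0 <= J s s.
Proof.
by move=> /(_ 1%N (fun=> 1) (fun=> s)); rewrite !big_ord1 conjC1 !mul1r.
Qed.

Lemma posdef_pullback (J : X -> X -> R[i]) : posdef J -> posdef (pullback phi J).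
Proof.
move=> pJ n c s.
under eq_bigr => a _ do under eq_bigr => b _ do rewrite mulr_sumr.
under eq_bigr => a _ do rewrite exchange_big.
by rewrite exchange_big sumr_ge0// => i _; exact: (pJ n c (phi i \o s)).
Qed.

Hypotheses (K_posdef : posdef K) (K_le : kernel_le K (pullback phi K)).

Lemma posdef_Kseq n : posdef (Kseq n).
Proof. by elim: n => [//|n IH]; exact: posdef_pullback. Qed.

Lemma Kseq_le n : kernel_le (Kseq n) (Kseq n.+1).
Proof.
elim: n => [//|n IH]; move: (posdef_pullback IH).
by congr posdef; apply/funext => s; apply/funext => t; exact: sumrB.
Qed.

Lemma diag_seq_ndecr s : nondecreasing_seq (fun n => (diag_seq n s)%:E).
Proof.
apply/nondecreasing_seqP => n; rewrite lee_fin.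
have /= := posdef_diag s (Kseq_le n).
by rewrite subr_ge0 lecE => /andP[].
Qed.

Lemma diag_seq_phi i n s : diag_seq n (phi i s) <= diag_seq n.+1 s.
Proof.
have : Kseq n (phi i s) (phi i s) <= Kseq n.+1 s s.
  rewrite [leRHS](bigD1 i)//= lerDl sumr_ge0// => j _.
  exact/posdef_diag/posdef_Kseq.
by rewrite lecE => /andP[].
Qed.

Lemma Xfin_phi i s : s \in Xfin -> phi i s \in Xfin.
Proof.
rewrite !inE /Xfin /=; apply: le_lt_trans.
apply: lime_le.
  by apply: ereal_nondecreasing_is_cvgn; exact: diag_seq_ndecr.
apply: nearW => n; apply: (@le_trans _ _ (diag_seq n.+1 s)%:E).
  by rewrite lee_fin diag_seq_phi.
rewrite /diag_lim (cvg_lim _ (ereal_nondecreasing_cvgn (@diag_seq_ndecr s)))//.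
by apply: ereal_sup_ubound; exists n.+1.
Qed.

Definition phi_fin (i : 'I_m) (s : Xfin) : Xfin :=
  exist _ (phi i (val s)) (Xfin_phi i (valP s)).

End SplittingKernel.

(* A Hilbert space of functions on Y with reproducing kernel J: vectors are
   identified with functions through the injective linear map [rkhs_eval].
   The inner product is linear in its first argument. *)
Record rkhs (R : realType) (Y : Type) (J : Y -> Y -> R[i]) := Rkhs {
  rkhs_space :> completeNormedModType R[i];
  rkhs_dot : {dot rkhs_space for Num.conj};
  rkhs_normE : forall f : rkhs_space, `|f| ^+ 2 = rkhs_dot f f;
  rkhs_eval : {linear rkhs_space -> (Y -> R[i]^o)};
  rkhs_eval_inj : injective rkhs_eval;
  rkhs_section : Y -> rkhs_space;
  rkhs_sectionE : forall s t : Y, rkhs_eval (rkhs_section s) t = J t s;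
  rkhs_reproducing : forall (f : rkhs_space) (s : Y),
    rkhs_eval f s = rkhs_dot f (rkhs_section s)
}.

Section Operators.
Variables (R : realType) (Y : Type) (J : Y -> Y -> R[i]) (H : rkhs J) (m : nat).

(* The squared norm of the Hilbert space direct sum of m copies of H. *)
Definition dsum_norm2 (F : {ffun 'I_m -> H}) : R[i] := \sum_(i < m) `|F i| ^+ 2.

Definition dsum_bounded (V : H -> {ffun 'I_m -> H}) : Prop :=
  exists M : R[i], forall f : H, dsum_norm2 (V f) <= M * `|f| ^+ 2.

Definition coord_op (V : H -> {ffun 'I_m -> H}) (i : 'I_m) : H -> H :=
  fun f => V f i.

(* The first letter of w acts first. *)
Definition word_op (V : H -> {ffun 'I_m -> H}) (w : seq 'I_m) : H -> H :=
  fun f => foldl (fun g i => coord_op V i g) f w.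

(* The default value 0 is not reached when T is linear and bounded. *)
Definition adjoint (T : H -> H) : H -> H :=
  fun g => xget 0 [set h | forall f, rkhs_dot H (T f) g = rkhs_dot H f h].

End Operators.

(* Being isometric is a consequence of these conditions. *)
Definition splitting_isometry (R : realType) (X : Type) (m : nat)
    (phi : 'I_m -> X -> X) (K : X -> X -> R[i]) (K_posdef : posdef K)
    (K_le : kernel_le K (pullback phi K)) (H : rkhs (@Kinf R X m phi K))
    (V : {linear H -> {ffun 'I_m -> H}}) : Prop :=
  dsum_bounded V /\
  forall s : Xfin phi K,
    V (rkhs_section H s) =
      [ffun i => rkhs_section H (phi_fin K_posdef K_le i s)].

(* Main.v *)
Require Import Defs.
From HB Require Import structures.
From mathcomp Require Import all_boot all_order all_algebra.
From mathcomp Require Import complex ring lra.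
From mathcomp Require Import all_classical all_reals all_analysis.

Set Implicit Arguments.
Unset Strict Implicit.
Unset Printing Implicit Defensive.

Import Order.TTheory GRing.Theory Num.Theory.
Import numFieldNormedType.Exports.

Local Open Scope classical_set_scope.
Local Open Scope complex_scope.
Local Open Scope ring_scope.

(** Each step of the splitting preserves inner products, and the letters of a
word are applied one step at a time, so everything reduces to the case of one
letter: [\sum_i <S_i f, S_i g> = <f, g>].

For one letter, let [L = \sum_i S_i^* S_i]. On kernel sections,
[<L k_s, k_t> = \sum_i K_inf (phi_i t) (phi_i s) = K_inf t s = <k_s, k_t>]
because [K_inf] is invariant under the pullback; as a vector is determined by
its inner products with the sections, [L k_s = k_s]. Since [L] is self-adjoint,
[<L f, k_s> = <f, L k_s> = <f, k_s>] for every [f], hence [L f = f]. This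
argument replaces the density of the span of the sections by the existence of
the adjoints.

Two facts carry it. The first is the existence of the adjoints, that is the
representation theorem of Riesz ([riesz_representation]). Its representing
vector is obtained as the minimizer of the energy [|f|^2 - 2 Re (l f)]: by the
parallelogram law ([normsqB_energy]) every minimizing sequence is Cauchy, and a
vector whose energy is within [e] of the infimum represents [l] up to an error
controlled by [e] ([energy_near_min]).

The second is the pullback invariance of [K_inf] ([Kinf_pullback]), which needs
the sequence [K_n s t] to converge. By polarization [K_n s t] is a combination
of four values of the quadratic form of [K_n] on the two points [s] and [t];
each of these is nondecreasing in [n], and bounded as soon as the diagonal
values are ([monotone_kernels_cvg]). *)

(** * Real parts and squared moduli *)

Section ComplexNumbers.
Variable R : realType.
Implicit Types (z w : R[i]) (x : R).

Definition sqmod z : R := complex.Re z ^+ 2 + complex.Im z ^+ 2.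

Lemma sqmodE z : `|z| ^+ 2 = (sqmod z)%:C.
Proof. by rewrite -add_Re2_Im2. Qed.

Lemma sqmod_ge0 z : 0 <= sqmod z.
Proof. by rewrite addr_ge0 ?sqr_ge0. Qed.

Lemma sqmod_eq0 z : sqmod z = 0 -> z = 0.
Proof.
move=> z0; apply/eqP; rewrite -normr_eq0.
by have := expf_eq0 `|z| 2; rewrite sqmodE z0 eqxx.
Qed.

Lemma sqmodD_le z w : sqmod (z + w) <= 2 * sqmod z + 2 * sqmod w.
Proof.
case: z w => [a b] [c d]; rewrite /sqmod /=.
have := sqr_ge0 (a - c); have := sqr_ge0 (b - d); lra.
Qed.

Lemma ReD z w : complex.Re (z + w) = complex.Re z + complex.Re w.
Proof. by case: z w => [? ?] [? ?]. Qed.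

Lemma ReN z : complex.Re (- z) = - complex.Re z.
Proof. by case: z. Qed.

Lemma ReJ z : complex.Re z^* = complex.Re z.
Proof. by case: z. Qed.

Lemma ReZ x z : complex.Re (x%:C * z) = x * complex.Re z.
Proof. by case: z => a b /=; rewrite mul0r subr0. Qed.

Lemma ReJM x z : complex.Re (x%:C * z^* * z) = x * sqmod z.
Proof. case: z => a b; rewrite /sqmod /=; ring. Qed.

Lemma sqmodJ x z : sqmod (x%:C * z^*) = x ^+ 2 * sqmod z.
Proof. case: z => a b; rewrite /sqmod /=; ring. Qed.

Lemma ge0_ReE z : 0 <= z -> z = (complex.Re z)%:C.
Proof. by move=> z0; rewrite RRe_real// ger0_real. Qed.

End ComplexNumbers.

(** * The Riesz representation theorem *)

Section RieszRepresentation.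
Variables (R : realType) (H : completeNormedModType R[i]).
Variable dot : {dot H for Num.conj}.
Hypothesis normE : forall f : H, `|f| ^+ 2 = dot f f.
Implicit Types (f g h : H) (l : {scalar H}).

Definition normsq f : R := complex.Re (dot f f).

Lemma dotE f : dot f f = (normsq f)%:C.
Proof. exact/ge0_ReE/dnorm_ge0. Qed.

Lemma normsq_ge0 f : 0 <= normsq f.
Proof. by rewrite -ler0c -dotE dnorm_ge0. Qed.

Lemma dot_conj f g : dot f g = (dot g f)^*.
Proof. by rewrite [LHS]hermC expr0 mul1r. Qed.

Lemma normsqD f g :
  normsq (f + g) = normsq f + normsq g + 2 * complex.Re (dot g f).
Proof.
rewrite /normsq linearDl/= !linearDr/= (dot_conj f g) !ReD ReJ; lra.
Qed.

Lemma normsqZ c f : normsq (c *: f) = sqmod c * normsq f.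
Proof.
by rewrite /normsq linearZl_LR/= linearZr_LR/= mulrA -normCK sqmodE ReZ.
Qed.

(** If [dot f h] represents [l], the energy of [f] is
    [normsq (f - h) - normsq h], so that [h] is its unique minimizer. *)
Definition energy l f : R := normsq f - 2 * complex.Re (l f).

Lemma energyD l f c g : energy l (f + c *: g) =
  energy l f + 2 * complex.Re (c * (dot g f - l g)) + sqmod c * normsq g.
Proof.
rewrite /energy normsqD normsqZ linearZl_LR/= [l (f + _)]linearD [l (c *: g)]linearZ/=.
rewrite mulrBr !ReD ReN; lra.
Qed.

(** The parallelogram law: the linear term cancels because the midpoint is taken
    with respect to the same [l]. Near-minimizers are therefore close to each
    other. *)
Lemma normsqB_energy l f g :
  normsq (f - g) = 2 * (energy l f + energy l g) -
                   4 * energy l ((2^-1)%:C *: (f + g)).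
Proof.
rewrite /energy normsqZ [l (_ *: _)]linearZ/= [l (f + g)]linearD/= ReZ ReD.
rewrite !normsqD -scaleN1r normsqZ linearZl_LR/= /sqmod/=.
have -> : complex.Re (-1 * dot g f) = - complex.Re (dot g f) by rewrite mulN1r ReN.
lra.
Qed.

(** Moving a near-minimizer along [g], in the direction that decreases the
    energy to first order, cannot gain more than [e]; this bounds the first
    order term. *)
Lemma energy_near_min l d e f g : (forall h, d <= energy l h) ->
  energy l f <= d + e -> sqmod (dot g f - l g) <= e * normsq g.
Proof.
move=> dl fe.
have {dl} tP t : 0 <= e + t ^+ 2 * sqmod (dot g f - l g) * normsq g
                     - 2 * t * sqmod (dot g f - l g).
  (* The conjugate makes the first order term real, of sign opposite to [t]. *)
  have := dl (f + ((- t)%:C * (dot g f - l g)^*) *: g).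
  rewrite energyD ReJM sqmodJ sqrrN; lra.
move: (sqmod_ge0 (dot g f - l g)) tP (normsq_ge0 g).
move: (sqmod _) (normsq g) => D n D0 tP n0.
have e0 : 0 <= e by have := tP 0; lra.
have [n_eq0|n_neq0] := eqVneq n 0.
  have [->|D_neq0] := eqVneq D 0; first by rewrite mulr_ge0.
  (* The second order term vanishes, so a large step contradicts the bound. *)
  have := tP ((e + 1) / (2 * D)).
  have -> : 2 * ((e + 1) / (2 * D)) * D = e + 1 by field.
  rewrite n_eq0 mulr0; lra.
(* The step that minimizes the right-hand side of tP. *)
have := tP n^-1.
have -> : n^-1 ^+ 2 * D * n = D / n by field.
have -> : 2 * n^-1 * D = 2 * (D / n) by field.
move=> h; rewrite -ler_pdivrMr ?lt_def ?n_neq0//; lra.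
Qed.

(** The Cauchy-Schwarz inequality is the case of the zero functional, whose
    energy is the squared norm: [f] is within [normsq f] of the infimum 0. *)
Lemma sqmod_dot_le f g : sqmod (dot g f) <= normsq f * normsq g.
Proof.
have E h : energy \0 h = normsq h by rewrite /energy/= mulr0 subr0.
have := @energy_near_min \0 0 (normsq f) f g.
rewrite !E/= subr0 add0r; apply=> // h.
by rewrite E normsq_ge0.
Qed.

Lemma dot_inj f g : (forall h, dot h f = dot h g) -> f = g.
Proof.
move=> fg; apply/eqP; rewrite -subr_eq0 -(dnorm_eq0 dot).
by rewrite linearBr/= fg subrr.
Qed.

Lemma ltr_norm_normsq f e : 0 < e -> (`|f| < e%:C) = (normsq f < e ^+ 2).
Proof.
move=> e0; rewrite -(ltr_pXn2r (_ : 0 < 2)%N) ?nnegrE ?normr_ge0 ?ler0c ?ltW//.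
by rewrite normE dotE -rmorphXn/= ltcR.
Qed.

(** By the bound on [l], [2 Re (l f) <= 2 sqrt (M |f|^2) <= M + |f|^2]. *)
Lemma energy_bounded l (M : R[i]) :
  (forall f, `|l f| ^+ 2 <= M * `|f| ^+ 2) -> exists d, forall f, d <= energy l f.
Proof.
move=> lM.
(* If H is trivial then M need not be real or nonnegative, hence the modulus. *)
exists (- complex.Re `|M|) => f.
have {}lM : sqmod (l f) <= complex.Re `|M| * normsq f.
  have : `|l f| ^+ 2 <= `|M| * `|f| ^+ 2.
    rewrite -[leLHS]ger0_norm ?exprn_ge0// -[X in _ * X]ger0_norm ?exprn_ge0//.
    rewrite -normrM ger0_norm ?exprn_ge0//.
    apply: (le_trans (lM f)); rewrite ger0_norm//.
    by apply: le_trans (lM f); rewrite exprn_ge0.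
  by rewrite sqmodE normE dotE (ge0_ReE (normr_ge0 M)) -rmorphM lecR.
have := normsq_ge0 f.
have : 0 <= complex.Re `|M| by rewrite -ler0c -ge0_ReE.
move: lM; rewrite /energy /sqmod.
move: (complex.Re `|M|) (normsq f) (complex.Re (l f)) (complex.Im (l f)).
move=> m n a b lM m0 n0.
have : `|2 * a| <= m + n.
  rewrite -(ler_pXn2r (_ : 0 < 2)%N) ?nnegrE ?addr_ge0// real_normK ?num_real//.
  have := sqr_ge0 (m - n); have := sqr_ge0 b; lra.
have := ler_norm (2 * a); lra.
Qed.

(** The representing vector is the limit of a minimizing sequence of the
    energy. *)
Theorem riesz_representation l (M : R[i]) :
  (forall f, `|l f| ^+ 2 <= M * `|f| ^+ 2) -> exists h, forall f, l f = dot f h.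
Proof.
move=> /energy_bounded[d0 d0P].
pose d := inf (range (energy l)).
have lbE : has_lbound (range (energy l)) by exists d0 => _ [f _ <-].
have dP f : d <= energy l f by apply: ge_inf => //; exists f.
have /choice[f_ f_P] k : exists f, energy l f <= d + k.+1%:R^-1.
  have k0 : 0 < k.+1%:R^-1 :> R by [].
  have iE : has_inf (range (energy l)) by split=> //; exists (energy l 0), 0.
  by have [_ [f _ <-] /ltW fk] := inf_adherent k0 iE; exists f.
have f_cvg : cvgn f_.
  apply: cauchy_cvg; apply: cauchy_exP => eps eps0.
  have epsE := ge0_ReE (ltW eps0); rewrite epsE (ltcR 0) in eps0.
  move: (complex.Re eps) epsE eps0 => e -> e0 {eps}.
  have e2_gt0 : 0 < e ^+ 2 / 4 by rewrite divr_gt0 ?exprn_gt0.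
  have [N N_le] := ltr_add_invr e2_gt0.
  exists (f_ N).
  change (\forall k \near \oo, ball (f_ N) e%:C (f_ k)); near=> k.
  rewrite -ball_normE/= ltr_norm_normsq//.
  rewrite (normsqB_energy l).
  have kN : k.+1%:R^-1 <= N.+1%:R^-1 :> R.
    rewrite lef_pV2 ?posrE// ler_nat ltnS.
    by near: k; exact: nbhs_infty_ge.
  have := f_P N; have := f_P k; have := dP ((2^-1)%:C *: (f_ N + f_ k)).
  move: N_le kN; rewrite add0r; move: (N.+1%:R^-1) (k.+1%:R^-1) => a b; lra.
exists (limn f_) => g; apply/eqP; rewrite -subr_eq0 -oppr_eq0 opprB; apply/eqP.
apply: sqmod_eq0; apply/eqP; rewrite eq_le sqmod_ge0 andbT.
set D := _ - _.
have n0 := normsq_ge0 g.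
apply/ler_addgt0Pl => e e0; rewrite addr0.
(* The squared error is at most twice [r * normsq g] for the distance of [f_ k] to
   the limit, plus as much for the distance of its energy to the infimum. *)
pose r := e / (4 * (normsq g + 1)).
have r0 : 0 < r by rewrite divr_gt0// mulr_gt0// ltr_wpDl.
have rE : r * normsq g * 4 <= e.
  have re : r * (4 * (normsq g + 1)) = e.
    by rewrite divfK// gt_eqF// mulr_gt0// ltr_wpDl.
  lra.
have sqr0 : 0 < Num.sqrt r by rewrite sqrtr_gt0.
have sC0 : 0 < (Num.sqrt r)%:C by rewrite (ltcR 0).
near \oo => k.
have fk : normsq (limn f_ - f_ k) <= r.
  rewrite -[leRHS]sqr_sqrtr ?ltW// -ltr_norm_normsq//.
  by near: k; move/cvgrPdist_lt : f_cvg; exact.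
have kr : k.+1%:R^-1 <= r.
  by apply/ltW; near: k; exact: near_infty_natSinv_lt (PosNum r0).
have -> : D = dot g (limn f_ - f_ k) + (dot g (f_ k) - l g).
  by rewrite linearBr/= addrA subrK.
apply: (le_trans (sqmodD_le _ _)).
have h1 := sqmod_dot_le (limn f_ - f_ k) g.
have h2 := energy_near_min g dP (f_P k).
have p1 := ler_wpM2r n0 fk; have p2 := ler_wpM2r n0 kr.
move: (le_trans h1 p1) (le_trans h2 p2) rE; move: (r * _) (sqmod _) (sqmod _).
move=> a b c; lra.
Unshelve. all: by end_near.
Qed.

End RieszRepresentation.

(** * Monotone sequences of positive definite kernels *)

Section MonotoneKernels.
Variable R : realType.

Lemma ndecr_complex_cvg (u : nat -> R[i]) (B : R) :
  (forall n, 0 <= u n) -> (forall n, u n <= u n.+1) -> (forall n, u n <= B%:C) ->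
  cvgn (u : nat -> R[i]^o).
Proof.
move=> u0 u_ndecr u_le; pose x n := complex.Re (u n).
have uE n : u n = (x n)%:C by exact: ge0_ReE.
have x_cvg : cvgn x.
  apply: nondecreasing_is_cvgn.
    by apply/nondecreasing_seqP => n; rewrite -lecR -!uE.
  by exists B => _ [n _ <-]; rewrite -lecR -uE.
apply/cvg_ex; exists (limn x)%:C.
apply/cvgrPdist_lt => eps eps0.
have epsE := ge0_ReE (ltW eps0); rewrite epsE (ltcR 0) in eps0.
move/cvgrPdist_lt : x_cvg => /(_ _ eps0); apply: filterS => n.
by rewrite uE epsE -rmorphB/= normc_def/= expr0n addr0 sqrtr_sqr ltcR.
Qed.

(** The quadratic form of [J] on the points [s], [t] with coefficients 1, [c]. *)
Definition quadform2 (Y : Type) (J : Y -> Y -> R[i]) (s t : Y) (c : R[i]) : R[i] :=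
  J s s + c * J s t + c^* * J t s + c^* * c * J t t.

Lemma quadform2_ge0 (Y : Type) (J : Y -> Y -> R[i]) s t c :
  posdef J -> 0 <= quadform2 J s t c.
Proof.
move=> /(_ 2%N (fun a => if a == ord0 then 1 else c)
               (fun a => if a == ord0 then s else t)).
rewrite !big_ord_recl !big_ord0/= conjC1 !mul1r !addr0 mulr1.
by rewrite /quadform2 !addrA.
Qed.

Lemma polarization (Y : Type) (J : Y -> Y -> R[i]) s t :
  4 * J s t = quadform2 J s t 1 - quadform2 J s t (- 1)
              - 'i%C * (quadform2 J s t 'i%C - quadform2 J s t (- 'i%C)).
Proof.
have i2 : 'i%C * 'i%C = -1 :> R[i] by rewrite -expr2 sqr_i.
have iJ : ('i%C : R[i])^* = - 'i%C by apply/eqP; rewrite eq_complex/= oppr0 !eqxx.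
have JN (z : R[i]) : (- z)^* = - z^* by exact: rmorphN.
rewrite /quadform2 !JN conjC1 iJ.
move: (J s s) (J s t) (J t s) (J t t) i2 => a b c d.
move: ('i%C) => z z2.
transitivity (2 * (b + c) - 2 * (z * z) * (b - c)); last by ring.
rewrite z2; ring.
Qed.

(** Bounds on the diagonal suffice: the forms with coefficients [c] and [- c] are
    nonnegative and their sum only involves the diagonal, which bounds each of
    them. *)
Lemma monotone_kernels_cvg (Y : Type) (J : nat -> Y -> Y -> R[i]) (s t : Y) (M : R) :
  (forall n, posdef (J n)) -> (forall n, kernel_le (J n) (J n.+1)) ->
  (forall n, complex.Re (J n s s) <= M) -> (forall n, complex.Re (J n t t) <= M) ->
  cvgn (fun n => J n s t : R[i]^o).
Proof.
move=> pJ J_le sM tM.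
have q_cvg c : cvgn (fun n => quadform2 (J n) s t c : R[i]^o).
  apply: (@ndecr_complex_cvg _ (2 * (M + sqmod c * M))) => n.
  - exact: quadform2_ge0.
  - rewrite -subr_ge0.
    suff -> : quadform2 (J n.+1) s t c - quadform2 (J n) s t c
              = quadform2 (fun s t => J n.+1 s t - J n s t) s t c.
      exact/quadform2_ge0/J_le.
    by rewrite /quadform2; ring.
  - have qN := quadform2_ge0 s t (- c) (pJ n).
    have -> : quadform2 (J n) s t c = 2 * (J n s s + `|c| ^+ 2 * J n t t)
                                      - quadform2 (J n) s t (- c).
      have JN : (- c)^* = - c^* by exact: rmorphN.
      by rewrite /quadform2 normCK JN; ring.
    rewrite lerBlDr; apply: ler_wpDr qN _.
    rewrite sqmodE (ge0_ReE (posdef_diag s (pJ n))) (ge0_ReE (posdef_diag t (pJ n))).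
    have -> : 2 = 2%:C :> R[i] by rewrite rmorph_nat.
    rewrite -!rmorphM -rmorphD -rmorphM lecR ler_wpM2l// lerD// ler_wpM2l//.
    exact: sqmod_ge0.
have -> : (fun n => J n s t : R[i]^o) = (fun n => 4^-1 *
    (quadform2 (J n) s t 1 - quadform2 (J n) s t (- 1)
     - 'i%C * (quadform2 (J n) s t 'i%C - quadform2 (J n) s t (- 'i%C))) : R[i]^o).
  by apply/funext => n; rewrite -polarization mulKf// pnatr_eq0.
apply: is_cvgM; first exact: is_cvg_cst.
apply: is_cvgB; first exact: is_cvgB.
apply: is_cvgM; first exact: is_cvg_cst.
exact: is_cvgB.
Qed.

End MonotoneKernels.

(** * Pullback invariance of the limit kernel *)

Section PullbackLimit.
Variables (R : realType) (X : Type) (m : nat).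
Variables (phi : 'I_m -> X -> X) (K : X -> X -> R[i]).
Hypotheses (K_posdef : posdef K) (K_le : kernel_le K (pullback phi K)).

Lemma diag_seq_bounded (s : Xfin phi K) :
  exists M : R, forall n, diag_seq phi K n (val s) <= M.
Proof.
have sfin : (diag_lim phi K (val s) < +oo)%E by have := valP s; rewrite inE.
have ule n : ((diag_seq phi K n (val s))%:E <= diag_lim phi K (val s))%E.
  rewrite /diag_lim.
  rewrite (cvg_lim _ (ereal_nondecreasing_cvgn (diag_seq_ndecr K_le _)))//.
  by apply: ereal_sup_ubound; exists n.
have /fineK limE : diag_lim phi K (val s) \is a fin_num.
  by rewrite ge0_fin_numE// (le_trans _ (ule 0)) ?lee_fin//
    -ler0c -ge0_ReE ?posdef_diag.
by exists (fine (diag_lim phi K (val s))) => n; rewrite -lee_fin limE.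
Qed.

Lemma Kinf_cvg (s t : Xfin phi K) :
  (fun n => Kseq phi K n (val s) (val t) : R[i]^o) @ \oo --> (Kinf s t : R[i]^o).
Proof.
have [M sM] := diag_seq_bounded s; have [N tN] := diag_seq_bounded t.
apply: (@monotone_kernels_cvg _ _ _ _ _ (Num.max M N)).
- exact: posdef_Kseq.
- exact: Kseq_le.
- by move=> n; rewrite le_max [X in X || _]sM.
- by move=> n; rewrite le_max [X in _ || X]tN orbT.
Qed.

(** Both sides are the limit of [Kseq n.+1], whose definition is a pullback. *)
Lemma Kinf_pullback (s t : Xfin phi K) :
  \sum_(i < m) Kinf (phi_fin K_posdef K_le i s) (phi_fin K_posdef K_le i t)
    = Kinf s t.
Proof.
have sum_cvg : (fun n => Kseq phi K n.+1 (val s) (val t) : R[i]^o) @ \oo -->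
    (\sum_(i < m) Kinf (phi_fin K_posdef K_le i s) (phi_fin K_posdef K_le i t) : R[i]^o).
  by rewrite /=; apply: cvg_big => [|i _]; [exact: add_continuous|exact: Kinf_cvg].
have := @Kinf_cvg s t; rewrite -cvg_shiftS => KC.
exact: (cvg_unique (@norm_hausdorff _ _) sum_cvg KC).
Qed.

End PullbackLimit.

(** * Adjoints and words *)

Section SplittingIsometry.
Variables (R : realType) (Y : Type) (J : Y -> Y -> R[i]) (H : rkhs J).
Implicit Types f g h : H.

Local Notation dot := (rkhs_dot H).

Definition has_adjoint (T : H -> H) : Prop :=
  forall g, exists h, forall f, dot (T f) g = dot f h.

Lemma adjointP (T : H -> H) f g : has_adjoint T -> dot (T f) g = dot f (adjoint T g).
Proof.
by move=> /(_ g)[h hP]; rewrite /adjoint; case: xgetP => [h' _ ->//|/(_ h)].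
Qed.

Lemma has_adjoint_comp (S T : H -> H) :
  has_adjoint S -> has_adjoint T -> has_adjoint (S \o T).
Proof.
move=> aS aT g; have [h hP] := aS g; have [h' h'P] := aT h.
by exists h' => f; rewrite hP h'P.
Qed.

Lemma bounded_has_adjoint (T : {linear H -> H}) (M : R[i]) :
  (forall f, `|T f| ^+ 2 <= M * `|f| ^+ 2) -> has_adjoint T.
Proof.
move=> TM g.
have lin : scalar (fun f => dot (T f) g).
  by move=> c f f'; rewrite linearP/= linearPl.
pose l : {scalar H} := HB.pack (fun f => dot (T f) g)
  (GRing.isLinear.Build _ _ _ _ _ lin).
apply: (@riesz_representation _ _ dot (@rkhs_normE _ _ _ H) l (M * `|g| ^+ 2)) => f.
have := @sqmod_dot_le _ _ dot g (T f).
rewrite -lecR -sqmodE rmorphM/= -!dotE -!rkhs_normE => /le_trans; apply.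
by rewrite [leRHS]mulrAC [leLHS]mulrC ler_wpM2r// exprn_ge0.
Qed.

Lemma dot_section s t : dot (rkhs_section H s) (rkhs_section H t) = J t s.
Proof. by rewrite -rkhs_reproducing rkhs_sectionE. Qed.

Lemma section_inj f g :
  (forall s, dot f (rkhs_section H s) = dot g (rkhs_section H s)) -> f = g.
Proof.
move=> fg; apply: (@rkhs_eval_inj _ _ _ H); apply/funext => s.
by rewrite !rkhs_reproducing.
Qed.

Variables (m : nat) (V : H -> {ffun 'I_m -> H}).

(** Composing adjoints gives the adjoint of a word directly, without a bound on
    its norm. *)
Lemma has_adjoint_word :
  (forall i, has_adjoint (coord_op V i)) -> forall w, has_adjoint (word_op V w).
Proof.
move=> aV; elim => [g|i w IH]; first by exists g.
exact: has_adjoint_comp IH (aV i).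
Qed.

(** The operator [L], the sum of the [S_i^* S_i], is self-adjoint and fixes every
    section; hence [L f] and [f] have the same inner products with all sections
    and coincide. *)
Lemma sum_dot_coord :
  (forall i, has_adjoint (coord_op V i)) ->
  (forall s t, \sum_(i < m) dot (V (rkhs_section H s) i) (V (rkhs_section H t) i)
               = J t s) ->
  forall f g, \sum_(i < m) dot (V f i) (V g i) = dot f g.
Proof.
move=> aV VJ f g.
pose L f := \sum_(i < m) adjoint (coord_op V i) (V f i).
have LP f' g' : dot f' (L g') = \sum_(i < m) dot (V f' i) (V g' i).
  rewrite /L linear_sumr/=; apply: eq_bigr => i _.
  exact/esym/adjointP.
have LJ f' g' : dot (L f') g' = dot f' (L g').
  rewrite dot_conj !LP rmorph_sum; apply: eq_bigr => i _.
  by rewrite [RHS]dot_conj.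
have Lsection s : L (rkhs_section H s) = rkhs_section H s.
  by apply: section_inj => t; rewrite LJ LP VJ dot_section.
rewrite -LP; congr (dot f _).
by apply: section_inj => s; rewrite LJ Lsection.
Qed.

Lemma big_tuple_cons (A : nmodType) (I : finType) n (F : n.+1.-tuple I -> A) :
  \sum_(w : n.+1.-tuple I) F w =
  \sum_(i : I) \sum_(w : n.-tuple I) F [tuple of i :: w].
Proof.
rewrite pair_big/=.
rewrite (reindex (fun p : I * n.-tuple I => [tuple of p.1 :: p.2]))//=.
exists (fun w : n.+1.-tuple I => (thead w, [tuple of behead w])) => [[i w]|w] _.
  by congr (_, _); apply: val_inj.
by rewrite /= -tuple_eta.
Qed.

(** Induction on the length: the first letter acts first, so summing over the
    remaining letters removes them, and the identity for one letter removes the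
    first. *)
Lemma sum_dot_word :
  (forall f g, \sum_(i < m) dot (V f i) (V g i) = dot f g) ->
  forall n f g, \sum_(w : n.-tuple 'I_m) dot (word_op V w f) (word_op V w g)
                = dot f g.
Proof.
move=> Viso; elim=> [|n IH] f g.
  by rewrite (big_pred1 [tuple])// => w; apply/esym/eqP; exact: tuple0.
rewrite big_tuple_cons -Viso; apply: eq_bigr => i _.
exact: IH.
Qed.

End SplittingIsometry.

Theorem proposition4p6 (R : realType) (X : Type) (m : nat) (m_ge1 : (1 <= m)%N)
    (phi : 'I_m -> X -> X) (K : X -> X -> R[i])
    (K_posdef : posdef K) (K_le : kernel_le K (pullback phi K))
    (H : rkhs (Kinf (phi := phi) (K := K)))
    (V : {linear H -> {ffun 'I_m -> H}})
    (V_split : splitting_isometry K_posdef K_le V) (n : nat) :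
  (forall f : H, \sum_(w : n.-tuple 'I_m) `|word_op V w f| ^+ 2 = `|f| ^+ 2) /\
  \sum_(w : n.-tuple 'I_m) (adjoint (word_op V w) \o word_op V w)
    = idfun :> (H -> H).
Proof.
have [[M VM] Vsection] := V_split.
have coord_adj i : has_adjoint (coord_op V i).
  have lin : linear (coord_op V i).
    by move=> c f g; rewrite /coord_op linearP !ffunE.
  pose T : {linear H -> H} := HB.pack (coord_op V i)
    (GRing.isLinear.Build _ _ _ _ _ lin).
  apply: (@bounded_has_adjoint _ _ _ _ T M) => f; apply: le_trans (VM f).
  by rewrite /dsum_norm2 (bigD1 i)//= lerDl sumr_ge0// => j _; rewrite exprn_ge0.
have Viso := sum_dot_coord coord_adj.
have {Viso} /sum_dot_word Viso f g :
    \sum_(i < m) rkhs_dot H (V f i) (V g i) = rkhs_dot H f g.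
  apply: Viso => s t; rewrite -(Kinf_pullback K_posdef K_le t s).
  by apply: eq_bigr => i _; rewrite !Vsection !ffunE dot_section.
split=> [f|].
  by rewrite rkhs_normE -(Viso n); apply: eq_bigr => w _; rewrite rkhs_normE.
apply/funext => f; rewrite fct_sumE /=; apply: (@dot_inj _ _ (rkhs_dot H)) => g.
rewrite linear_sumr/= -[RHS](Viso n); apply: eq_bigr => w _.
exact/esym/adjointP/has_adjoint_word.
Qed.
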